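(* Let $G$ be a $2$-connected cubic graph on $n$ vertices (finite, loopless, parallel edges allowed), with $n$ sufficiently large. Then $G$ has a path of length at least $\frac{\log^2 n}{1+4\log\log n} - 36\log^2\log n$, where $\log=\log_2$.
   Context: The length of a path is its number of edges. *)

(* Defs.v *)
From mathcomp Require Import all_boot.
From Stdlib Require Import Reals.
Set Implicit Arguments. Unset Strict Implicit. Unset Printing Implicit Defensive.

(* A finite multigraph: vertex set V, edge set E, each edge has two ends.
   Parallel edges are allowed (distinct edges with the same ends). *)

Definition loopless (V E : finType) (ends : E -> V * V) : Prop :=
  forall e : E, (ends e).1 != (ends e).2.

Definition mdeg (V E : finType) (ends : E -> V * V) (v : V) : nat :=
  #|[set e | (ends e).1 == v]| + #|[set e | (ends e).2 == v]|.

Definition cubic (V E : finType) (ends : E -> V * V) : Prop :=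
  forall v : V, mdeg ends v = 3.

Definition madj (V E : finType) (ends : E -> V * V) : rel V :=
  fun x y => [exists e : E, (ends e == (x, y)) || (ends e == (y, x))].

Definition madj_del (V E : finType) (ends : E -> V * V) (w : V) : rel V :=
  fun x y => [&& madj ends x y, x != w & y != w].

Definition mconnected (V E : finType) (ends : E -> V * V) : Prop :=
  forall x y : V, connect (madj ends) x y.

Definition two_connected (V E : finType) (ends : E -> V * V) : Prop :=
  [/\ 3 <= #|V|, mconnected ends &
      forall w x y : V, x != w -> y != w -> connect (madj_del ends w) x y].

(* a path x :: p : distinct vertices, consecutive ones adjacent;
   its length (number of edges) is size p *)
Definition is_mpath (V E : finType) (ends : E -> V * V) (x : V) (p : seq V) : Prop :=
  path (madj ends) x p /\ uniq (x :: p).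

Definition log2 (x : R) : R := (ln x / ln 2)%R.

(* Main.v *)
(* Only the underlying simple graph of maximum degree 3 matters. Call a vertex set X
   traversable from u to v if every vertex of X lies on a simple u-v path inside X.
   Balls in the graph have at most 3 * 2^r vertices, so some vertex of X is at distance
   about log |X| from both u and v, and a u-v path P of X through it has about 2 log |X|
   vertices. A vertex of P has at most one neighbour off P (its ends at most two), so
   at most |P| + 2 vertices of X \ P touch P. Choose one of them, the entry, in each
   component of X \ P; each w in X \ P lies on a path avoiding P from the entry of its
   component to another vertex touching P. Grouping the w's by the latter, some group
   spans a set X' with |X'| >= (|X| - |P|) / (|P| + 2) that is traversable between two
   vertices touching P. A long path of X' starting at either of them extends by at least
   half of P, i.e. by log |X| vertices. While |P| < 2^k = O(log^2 n), each
   step divides |X| by at most 2^k, and summing the gains over the log n / k steps gives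
   log^2 n / (2k); if |P| >= 2^k at some step, P itself is long enough. *)

Require Import Defs.
From Stdlib Require Import ZArith Reals Lra.
From mathcomp Require Import all_boot zify.
Set Implicit Arguments. Unset Strict Implicit. Unset Printing Implicit Defensive.

(** * Simple paths as vertex lists: splitting, joining and reversing *)

Section SimplePaths.
Variable V : finType.
Implicit Types (g : rel V) (u v w x y z : V) (s t : seq V).

(** The list holds all vertices, the first included, so that reversal and splitting are plain list
    operations. The condition on [ohead] excludes the empty list, so the default of [last] never
    matters. *)
Definition spath g u v s : bool :=
  [&& ohead s == Some u, last u s == v, sorted g s & uniq s].

Lemma spath_cons g u v s :
  spath g u v s -> exists2 p, s = u :: p & [&& path g u p, last u p == v & uniq (u :: p)].
Proof.
case: s => [|x p] /and4P[//] /eqP[->] e1 e2 e3; exists p => //.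
by rewrite e1 e3 andbT; apply/andP.
Qed.

Lemma spath_head g u v s : spath g u v s -> u \in s.
Proof. by case/spath_cons => p -> _; rewrite mem_head. Qed.

Lemma spath_last g u v s : spath g u v s -> v \in s.
Proof. by case/spath_cons => p -> /and3P[_ /eqP <- _]; rewrite mem_last. Qed.

Lemma spath_uniq g u v s : spath g u v s -> uniq s.
Proof. by case/and4P. Qed.

Lemma sub_spath g g' u v s : subrel g g' -> spath g u v s -> spath g' u v s.
Proof.
move=> gg' /and4P[e1 e2 e3 e4]; apply/and4P; split=> //.
exact: sub_sorted e3.
Qed.

Lemma spath_rev g u v s : symmetric g -> spath g v u (rev s) = spath g u v s.
Proof.
move=> g_sym; suff H u' v' s' : spath g u' v' s' -> spath g v' u' (rev s').
  by apply/idP/idP => /H //; rewrite revK.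
case/spath_cons => p -> /and3P[pp /eqP lp up]; apply/and4P.
rewrite rev_uniq up rev_sorted; split=> //; first by rewrite lastI rev_rcons lp.
  by rewrite rev_cons last_rcons.
by rewrite (eq_sorted (e' := g)) // => a b; rewrite g_sym.
Qed.

Lemma spath_cat g u v a b s t :
  spath g u v (rcons s a ++ b :: t) =
  [&& spath g u a (rcons s a), spath g b v (b :: t), g a b &
      ~~ has [in rcons s a] (b :: t)].
Proof.
have -> : spath g u a (rcons s a) = [&& ohead (rcons s a) == Some u, sorted g (rcons s a) & uniq (rcons s a)].
  by rewrite /spath last_rcons eqxx.
have -> : spath g b v (b :: t) = [&& last b t == v, path g b t & uniq (b :: t)].
  by rewrite /spath /= eqxx.
have -> : spath g u v (rcons s a ++ b :: t) =
  [&& ohead (rcons s a) == Some u, last b t == v, [&& sorted g (rcons s a), g a b & path g b t] & uniq (rcons s a ++ b :: t)].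
  rewrite /spath last_cat /=; congr [&& _, _, _ & _]; first by case: (s).
  by case: s => [|c s] //=; rewrite cat_path last_rcons.
rewrite cat_uniq.
move: (ohead _ == _) (last _ _ == _) (sorted _ _) (g a b) (path _ _ _).
by move: (uniq (rcons _ _)) (~~ _) (uniq (_ :: _)); do 8![case].
Qed.

Lemma spath_cat_mid g u v w s t :
  spath g u v (s ++ w :: t) =
  [&& spath g u w (rcons s w), spath g w v (w :: t) & ~~ has [in rcons s w] t].
Proof.
rewrite -cat_rcons; case: t => [|b t].
  rewrite cats0 /= andbT.
  have -> : spath g w v [:: w] = (w == v) by rewrite /spath /= eqxx !andbT.
  have [<-|nwv] := eqVneq w v; first by rewrite andbT.
  by rewrite andbF /spath last_rcons (negbTE nwv) andbF.
rewrite spath_cat.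
have -> : spath g w v (w :: b :: t) = [&& spath g b v (b :: t), g w b & w \notin b :: t].
  rewrite /spath /= !eqxx /=.
  by move: (last _ _ == _) (g w b) (path _ _ _) (w \notin _) ((b \notin t) && _); do 5![case].
case: (boolP (has _ _)) => [_|nh]; first by rewrite !andbF.
have -> : w \notin b :: t.
  by apply: contra nh => wb; apply/hasP; exists w => //; rewrite /= mem_rcons mem_head.
by rewrite !andbT.
Qed.

Lemma spath_first_hit (S : {pred V}) g u v s :
  spath g u v s -> v \in S ->
  exists t z t', [/\ s = t ++ z :: t', z \in S & {in t, forall x, x \notin S}].
Proof.
move=> /spath_last vs vS.
have hs : has [in S] s by apply/hasP; exists v.
case: (split_find hs) => z t t' zS nt.
exists t, z, t'; rewrite cat_rcons; split=> // x xt.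
by apply: contra nt => xS; apply/hasP; exists x.
Qed.

Lemma connect_spath g u v : connect g u v -> exists s, spath g u v s.
Proof.
case/connectP => p pp ->; case: (shortenP pp) => p' pp' up' _.
by exists (u :: p'); rewrite /spath /= !eqxx pp'.
Qed.

Lemma connect_first_hit (S : {pred V}) g u v :
  connect g u v -> v \in S ->
  exists t z, [/\ spath g u z (rcons t z), z \in S & {in t, forall x, x \notin S}].
Proof.
case/connect_spath => s ss vS.
have [t [z [t' [es zS nt]]]] := spath_first_hit ss vS.
by move: ss; rewrite es spath_cat_mid => /and3P[? _ _]; exists t, z.
Qed.

End SimplePaths.

(** * Maximum degree three: growth of balls *)

Section Subcubic.
Variables (V : finType) (g : rel V).
Hypothesis g_sym : symmetric g.
Hypothesis g_irr : irreflexive g.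
Hypothesis g_deg : forall x, #|[set y | g x y]| <= 3.
Implicit Types (X Y S D : {set V}) (u v w x y z : V) (s t : seq V).

(* Endpoints of paths of length at most k from u that do not start towards a;
   taking a = u imposes no restriction. *)
Fixpoint ball k a u : {set V} :=
  if k is k'.+1 then u |: \bigcup_(x | g u x && (x != a)) ball k' u x
  else [set u].

Lemma card_bigcup_le_sum (I : finType) (P : pred I) (F : I -> {set V}) :
  #|\bigcup_(i | P i) F i| <= \sum_(i | P i) #|F i|.
Proof.
elim/big_rec2: _ => [|i m A Pi le]; first by rewrite cards0.
by apply: leq_trans (leq_card_setU _ _) _; rewrite leq_add2l.
Qed.

Lemma card_bigcup_le (I : finType) (P : pred I) (F : I -> {set V}) c :
  (forall i, P i -> #|F i| <= c) -> #|\bigcup_(i | P i) F i| <= #|P| * c.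
Proof.
move=> Fc; rewrite -sum_nat_const; apply: leq_trans (card_bigcup_le_sum _ _) _.
exact: leq_sum.
Qed.

Lemma card_nbrs_but1 a u : g u a -> #|[pred x | g u x && (x != a)]| <= 2.
Proof.
move=> ua; have := g_deg u; rewrite (cardsD1 a) inE ua ltnS.
by congr (_ <= _); apply: eq_card => x; rewrite !inE andbC.
Qed.

(** One step of the recursion, used with [d = 2] at inner vertices, where the predecessor is
    excluded, and with [d = 3] at the centre. *)
Lemma card_ball_succ k a u d :
  #|[pred x | g u x && (x != a)]| <= d ->
  (forall x, g u x -> #|ball k u x| < 2 ^ k.+1) ->
  #|ball k.+1 a u| <= 1 + d * (2 ^ k.+1).-1.
Proof.
move=> nd IH; apply: leq_trans (leq_card_setU _ _) _.
rewrite cards1 leq_add2l; apply: leq_trans (leq_mul nd (leqnn _)).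
apply: card_bigcup_le => x /andP[/IH ux _].
rewrite -/(ball _ _ _); have := expn_gt0 2 k.+1; lia.
Qed.

Lemma card_ball k a u : g u a -> #|ball k a u| < 2 ^ k.+1.
Proof.
elim: k a u => [|k IHk] a u ua; first by rewrite cards1.
apply: leq_ltn_trans (card_ball_succ (card_nbrs_but1 ua) (fun x ux => IHk u x (etrans (g_sym x u) ux))) _.
rewrite [2 ^ k.+2]expnS; case: (2 ^ k.+1) (expn_gt0 2 k.+1) => // e _; lia.
Qed.

Lemma card_ball0 k u : #|ball k u u| <= 3 * 2 ^ k.
Proof.
case: k => [|k]; first by rewrite cards1.
have n3 : #|[pred x | g u x && (x != u)]| <= 3.
  apply: leq_trans (g_deg u); apply: subset_leq_card.
  by apply/subsetP => x; rewrite !inE => /andP[].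
apply: leq_trans (card_ball_succ n3 (fun x ux => @card_ball k u x (etrans (g_sym x u) ux))) _.
case: (2 ^ k.+1) (expn_gt0 2 k.+1) => // e _; lia.
Qed.

Lemma path_ball k a u p :
  path g u p -> uniq (u :: p) -> a \notin p -> size p <= k -> last u p \in ball k a u.
Proof.
elim: k a u p => [|k IHk] a u [|x p] //=; try by rewrite !inE eqxx.
move=> /andP[ux pp] /and3P[]; rewrite !inE !negb_or.
move=> /andP[nux up] xp unp /andP[nax ap] sz.
apply/orP; right; apply/bigcupP; exists x; first by rewrite ux eq_sym.
by apply: IHk => //=; rewrite xp.
Qed.

(** * Long paths in large traversable sets *)

Definition traversable X u v : Prop :=
  forall w, w \in X -> exists s, [/\ spath g u v s, {subset s <= X} & w \in s].

Lemma far_size k u w s : spath g u w (rcons s w) -> w \notin ball k u u -> k < size s.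
Proof.
move=> ss; apply: contraR; rewrite -leqNgt => sk.
have [p e /and3P[pp /eqP <- /= /andP[up uqp]]] := spath_cons ss.
have := congr1 size e; rewrite size_rcons => -[es].
by apply: path_ball => //=; rewrite ?up // -es.
Qed.

(** The balls of radius [k] around [u] and [v] have at most [6 * 2 ^ k] vertices together, so some
    [w] of [X] misses both. A path through [w] has at least [k.+1] vertices on each side of it. *)
Lemma traversable_long X u v k :
  traversable X u v -> 6 * 2 ^ k < #|X| ->
  exists s, [/\ spath g u v s, {subset s <= X} & 2 * k + 3 <= size s].
Proof.
move=> tX kX.
have : ~~ (X \subset ball k u u :|: ball k v v).
  apply/negP => /subset_leq_card; apply/negP; rewrite -ltnNge.
  apply: leq_ltn_trans kX; apply: leq_trans (leq_card_setU _ _) _.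
  have := card_ball0 k u; have := card_ball0 k v; lia.
case/subsetPn => w wX; rewrite inE negb_or => /andP[wu wv].
have [s [ss sX ws]] := tX _ wX.
exists s; split=> //; case/path.splitPr: ws ss => s1 s2.
rewrite spath_cat_mid => /and3P[p1 p2 _].
have := far_size p1 wu; move: p2; rewrite -spath_rev // rev_cons => p2.
by have := far_size p2 wv; rewrite size_cat size_rev /=; lia.
Qed.

(** * Neighbours off a path *)

Definition nbrs_out (S : {set V}) x : {set V} := [set y | g x y] :\: S.

(** Here [a] is the predecessor of [x]. A vertex with both a predecessor and a successor in [S] has
    at most one neighbour outside; the last vertex has at most two. *)
Lemma sum_nbrs_out_tail (S : {set V}) a x p :
  a \in S -> g x a -> path g x p -> uniq (x :: p) -> a \notin p ->
  {subset x :: p <= S} -> \sum_(y <- x :: p) #|nbrs_out S y| <= size p + 2.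
Proof.
elim: p a x => [|y p IHp] a x aS xa /=.
  rewrite big_seq1 => _ _ _ _; apply: leq_trans (card_nbrs_but1 xa).
  apply: subset_leq_card; apply/subsetP => y; rewrite !inE => /andP[yS ->] /=.
  by apply: contraNneq yS => ->.
move=> /andP[xy pp] /and3P[xp yp uqp] ap sS.
rewrite big_cons addSn -add1n leq_add //; last first.
  apply: (IHp x) => //; rewrite 1?g_sym //=; first by apply: sS; rewrite mem_head.
  - by rewrite yp.
  - by move: xp; rewrite inE negb_or => /andP[].
  - by move=> z zp; apply: sS; rewrite inE zp orbT.
rewrite -ltnS; apply: leq_trans (card_nbrs_but1 xa).
have yS : y \in S by apply: sS; rewrite !inE eqxx orbT.
have -> : #|nbrs_out S x|.+1 = #|y |: nbrs_out S x| by rewrite cardsU1 !inE yS.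
apply: subset_leq_card; apply/subsetP => z; rewrite !inE => /predU1P[->|/andP[zS ->]].
  by rewrite xy /=; apply: contraNneq ap => ->; rewrite mem_head.
by apply: contraNneq zS => ->.
Qed.

(** The first vertex, having no predecessor, may contribute two; a one-vertex path may contribute
    three, which is still [size s + 2]. *)
Lemma sum_nbrs_out (S : {set V}) u v s :
  spath g u v s -> {subset s <= S} -> \sum_(y <- s) #|nbrs_out S y| <= size s + 2.
Proof.
case/spath_cons => -[|y p] -> /and3P[pp _ uqp] sS.
  rewrite big_seq1; apply: leq_trans (g_deg u).
  by apply: subset_leq_card; apply/subsetP => y; rewrite !inE => /andP[].
move: pp uqp => /= /andP[uy pp] /and3P[up yp uqp].
apply: (@leq_trans (2 + (size p + 2))); last by rewrite /=; lia.
rewrite big_cons leq_add //; last first.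
  apply: (@sum_nbrs_out_tail _ u) => //; rewrite 1?g_sym //=.
  - by apply: sS; rewrite mem_head.
  - by rewrite yp.
  - by move: up; rewrite inE negb_or => /andP[].
  - by move=> z zp; apply: sS; rewrite inE zp orbT.
apply: leq_trans (card_nbrs_but1 uy).
apply: subset_leq_card; apply/subsetP => z; rewrite !inE => /andP[zS ->].
by apply: contraNneq zS => ->; apply: sS; rewrite !inE eqxx orbT.
Qed.

(** * Components of the complement of a path, and their entries *)

Definition restr (Y : {set V}) : rel V := fun x y => [&& g x y, x \in Y & y \in Y].

Lemma restr_sym Y : symmetric (restr Y).
Proof. by move=> x y; rewrite /restr g_sym [(x \in Y) && _]andbC. Qed.

Lemma restr_path_sub Y x p : path (restr Y) x p -> {subset p <= Y}.
Proof.
elim: p x => //= y p IHp x /andP[/and3P[_ _ yY] /IHp pY] z.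
by rewrite inE => /predU1P[->|/pY].
Qed.

Lemma restr_spath_sub Y x y s : x \in Y -> spath (restr Y) x y s -> {subset s <= Y}.
Proof.
move=> xY /spath_cons[p -> /and3P[/restr_path_sub pY _ _]] z.
by rewrite inE => /predU1P[->|/pY].
Qed.

Lemma spath_restr (Y : {set V}) x y s : spath g x y s -> {subset s <= Y} -> spath (restr Y) x y s.
Proof.
case/and4P => e1 e2 e3 e4 sY; apply/and4P; split=> //.
move: e3 sY; case: s {e1 e2 e4} => // z s /=.
elim: s z => //= a s IHs z /andP[za ps] sY; rewrite IHs //; last first.
  by move=> b bs; apply: sY; rewrite inE bs orbT.
by rewrite /restr za !sY // !inE eqxx ?orbT.
Qed.

Lemma spath_connect g' x y s z : spath g' x y s -> z \in s -> connect g' x z.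
Proof.
move=> ss zs; case/path.splitPr: zs ss => s1 s2; rewrite spath_cat_mid => /and3P[+ _ _].
case/spath_cons => p _ /and3P[pp /eqP <- _]; apply/connectP; by exists p.
Qed.

Definition fringe (Y S : {set V}) : {set V} := [set y in Y | [exists x in S, g x y]].

(** The path is cut just before its first vertex in [S]. *)
Lemma spath_exit X (S : {set V}) w v s :
  spath g w v s -> {subset s <= X} -> w \notin S -> v \in S ->
  exists t b, [/\ spath g w b t, {subset t <= X :\: S}, {subset t <= s} & b \in fringe (X :\: S) S].
Proof.
move=> ss sX wS vS.
have [t [z [t' [es zS nt]]]] := spath_first_hit ss vS.
case/lastP: t => [|t b] in es nt.
  by move: wS; have [p es'] := spath_cons ss; move: es; rewrite es' => -[-> _]; rewrite zS.
move: ss; rewrite es spath_cat => /and4P[st _ bz _].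
have tX : {subset rcons t b <= X :\: S}.
  by move=> x xt; rewrite inE (nt _ xt); apply: sX; rewrite es mem_cat xt.
exists (rcons t b), b; split=> // [x xt|]; first by rewrite mem_cat xt.
rewrite inE tX ?mem_rcons ?mem_head //=.
by apply/existsP; exists z; rewrite zS g_sym.
Qed.

(** From [w], the [u]-[v] path through it is followed in both directions until just before it meets
    [S]. *)
Lemma traversable_segment X (S : {set V}) u v w :
  traversable X u v -> u \in S -> v \in S -> w \in X :\: S ->
  exists t a b, [/\ spath g a b t, {subset t <= X :\: S}, w \in t,
     a \in fringe (X :\: S) S & b \in fringe (X :\: S) S].
Proof.
move=> tX uS vS; rewrite inE => /andP[wS wX].
have [s [ss sX ws]] := tX _ wX.
case/path.splitPr: ws ss sX => s1 s2; rewrite spath_cat_mid => /and3P[p1 p2 /hasPn n12] sX.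
have {}p1 : spath g w u (w :: rev s1) by rewrite -rev_rcons spath_rev.
have [|t1 [a [q1 t1X t1s aD]]] := spath_exit (X := X) p1 _ wS uS.
  by move=> x xs; apply: sX; rewrite -cat_rcons mem_cat mem_rcons inE -mem_rev -in_cons xs.
have [|t2 [b [q2 t2X t2s bD]]] := spath_exit (X := X) p2 _ wS vS.
  by move=> x xs; apply: sX; rewrite mem_cat xs orbT.
have [r1 e1 _] := spath_cons q1; have [r2 e2 _] := spath_cons q2.
exists (rev r1 ++ w :: r2), a, b; split=> //.
- rewrite spath_cat_mid -rev_cons -e1 -e2 spath_rev // q1 q2 /=.
  apply/hasPn => x xr2 /=; rewrite mem_rev.
  have xw : x != w.
    by have /= := spath_uniq q2; rewrite e2 => /andP[wr _]; apply: contraNneq wr => <-.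
  have : x \in w :: s2 by apply: t2s; rewrite e2 inE xr2 orbT.
  rewrite inE (negbTE xw) => /n12 /=.
  by apply: contra => /t1s; rewrite mem_rcons !inE mem_rev.
- move=> x; rewrite mem_cat mem_rev => /orP[xr|xr].
    by apply: t1X; rewrite e1 inE xr orbT.
  by apply: t2X; rewrite e2.
- by rewrite mem_cat mem_head orbT.
Qed.

(** A canonical vertex of [D] in the component of [y]: equivalent predicates give the same [pick],
    so connected vertices share it. The default [y] occurs only if the component misses [D]. *)
Definition entry (Y D : {set V}) y : V := odflt y [pick z in D | connect (restr Y) y z].

Lemma entry_eq Y D x y : connect (restr Y) x y -> entry Y D x = odflt x [pick z in D | connect (restr Y) y z].
Proof.
move=> xy; congr odflt; apply: eq_pick => z /=.
by rewrite (same_connect (sym_connect_sym (restr_sym Y)) xy).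
Qed.

Lemma entryP Y D x d : d \in D -> connect (restr Y) x d ->
  entry Y D x \in D /\ connect (restr Y) x (entry Y D x).
Proof.
by move=> dD xd; rewrite /entry; case: pickP => [z /andP[]//|/(_ d)]; rewrite dD xd.
Qed.

Lemma entry_connect Y D x y d : d \in D -> connect (restr Y) x d ->
  connect (restr Y) x y -> entry Y D x = entry Y D y.
Proof.
move=> dD xd xy; rewrite (entry_eq _ xy) /entry.
case: pickP => // /(_ d); rewrite dD /=.
by rewrite -(same_connect (sym_connect_sym (restr_sym Y)) xy) xd.
Qed.

(** A path inside [Y] from the entry of [w] first meets the segment through [w] at some [z], then
    follows the half of the segment containing [w]. It ends at [b] in the same component, so its
    start is also the entry of [b]. *)
Lemma entry_exit_path X (S : {set V}) u v w :
  traversable X u v -> u \in S -> v \in S -> w \in X :\: S ->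
  let Y := X :\: S in let D := fringe Y S in
  exists b t, [/\ b \in D, entry Y D b \in D, spath g (entry Y D b) b t, {subset t <= Y} & w \in t].
Proof.
move=> tX uS vS wY Y D.
have [T [b1 [b2 [sT TY wT b1D b2D]]]] := traversable_segment tX uS vS wY.
have wb1 : connect (restr Y) w b1.
  rewrite (sym_connect_sym (restr_sym Y)).
  exact: spath_connect (spath_restr sT TY) wT.
have [aD wa] := entryP b1D wb1; set a := entry Y D w in aD wa.
have aY : a \in Y by move: aD; rewrite inE => /andP[].
have aw : connect (restr Y) a w by rewrite (sym_connect_sym (restr_sym Y)).
have [t [z [st zT nt]]] := connect_first_hit aw wT.
have tY := restr_spath_sub aY st.
have {st}st : spath g a z (rcons t z).
  by apply: sub_spath st => x y /and3P[].
(* Stated for an arbitrary [q] so as to serve both halves of the segment, the first one reversed. *)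
have finish b q : b \in D -> spath g z b (z :: q) -> {subset z :: q <= T} -> w \in z :: q ->
    exists b t, [/\ b \in D, entry Y D b \in D, spath g (entry Y D b) b t, {subset t <= Y} & w \in t].
  move=> bD sq qT wq.
  have spat : spath g a b (t ++ z :: q).
    rewrite spath_cat_mid st sq /=; apply/hasPn => x xq /=.
    rewrite mem_rcons inE negb_or; apply/andP; split.
      by have /= /andP[zq _] := spath_uniq sq; apply: contraNneq zq => <-.
    by apply/negP => /nt; rewrite qT // inE xq orbT.
  have patY : {subset t ++ z :: q <= Y}.
    move=> x; rewrite mem_cat => /orP[xt|/qT/TY//].
    by apply: tY; rewrite mem_rcons inE xt orbT.
  have ab : connect (restr Y) a b.
    by apply: spath_connect (spath_restr spat patY) _; apply: spath_last spat.
  have eb : entry Y D b = a.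
    rewrite -(entry_connect aD wa (connect_trans wa ab)) //.
  exists b, (t ++ z :: q); rewrite eb; split=> //.
  by rewrite mem_cat wq orbT.
case/path.splitPr: zT sT wT finish nt {TY} => T1 T2.
rewrite spath_cat_mid => /and3P[s1 s2 _] + finish _.
rewrite mem_cat => /orP[wT1|wT2]; last by apply: finish s2 _ wT2 => // x xz; rewrite mem_cat xz orbT.
apply: (finish b1 (rev T1)) => //.
- by rewrite -rev_rcons spath_rev.
- by move=> x; rewrite -rev_rcons mem_rev -cat_rcons mem_cat => ->.
- by rewrite inE mem_rev wT1 orbT.
Qed.

(** * Peeling off one path and recursing *)

Lemma card_fringe X u v s : spath g u v s -> {subset s <= X} ->
  #|fringe (X :\: [set x in s]) [set x in s]| <= size s + 2.
Proof.
move=> ss sX.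
have H : {subset s <= [set x in s]} by move=> x; rewrite inE.
apply: leq_trans (sum_nbrs_out ss H).
rewrite big_uniq ?(spath_uniq ss) //=; apply: leq_trans (card_bigcup_le_sum _ _).
apply: subset_leq_card; apply/subsetP => y; rewrite !inE => /andP[/andP[ys _]].
case/existsP => x /andP[]; rewrite inE => xs xy; apply/bigcupP; exists x => //.
by rewrite !inE ys.
Qed.

(** Every [w] off [s] chooses an exit [b] and a path to it from the entry of [b]. Since [b]
    determines that entry, all [w] with the same exit have paths with the same two ends. By
    pigeonhole over at most [size s + 2] exits, some class is large enough. *)
Lemma traversable_off_path X u v s :
  traversable X u v -> spath g u v s -> {subset s <= X} -> size s < #|X| ->
  exists X' a b, [/\ traversable X' a b, X' \subset X :\: [set x in s],
    [exists x in s, g x a], [exists x in s, g x b] & #|X| - size s <= (size s + 2) * #|X'|].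
Proof.
move=> tX ss sX szX; set S := [set x in s]; set Y := X :\: S; set D := fringe Y S.
have uS : u \in S by rewrite inE (spath_head ss).
have vS : v \in S by rewrite inE (spath_last ss).
have [f fP] : exists f : V -> V * seq V, forall w, w \in Y ->
  [/\ (f w).1 \in D, entry Y D (f w).1 \in D,
      spath g (entry Y D (f w).1) (f w).1 (f w).2, {subset (f w).2 <= Y} & w \in (f w).2].
  apply: (@fin_all_exists V (fun=> (V * seq V)%type) (fun w c => w \in Y ->
    [/\ c.1 \in D, entry Y D c.1 \in D, spath g (entry Y D c.1) c.1 c.2,
        {subset c.2 <= Y} & w \in c.2])) => w.
  case: (boolP (w \in Y)) => [wY|_]; last by exists (w, [::]).
  by have [b [t H]] := entry_exit_path tX uS vS wY; exists (b, t).
have cS : #|S| = size s by rewrite cardsE; apply/card_uniqP; apply: spath_uniq ss.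
have cY : #|Y| = #|X| - size s.
  rewrite cardsD (setIidPr _) ?cS //.
  by apply/subsetP => x; rewrite inE => /sX.
have /card_gt0P[w0 w0Y] : 0 < #|Y| by rewrite cY subn_gt0.
have [d0 _ _ _ _] := fP _ w0Y.
pose cls b := [set w in Y | (f w).1 == b].
have [b0 b0D b0max] : exists2 b, b \in D & forall b', b' \in D -> #|cls b'| <= #|cls b|.
  by case: (arg_maxnP (fun b => #|cls b|) d0) => b bD H; exists b.
have Ycls : #|Y| <= (size s + 2) * #|cls b0|.
  apply: leq_trans (leq_mul (card_fringe ss sX) (leqnn _)).
  apply: leq_trans (card_bigcup_le b0max); apply: subset_leq_card.
  apply/subsetP => w wY; apply/bigcupP; exists (f w).1; first by case: (fP _ wY).
  by rewrite inE wY /=.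
have [w1 w1c] : exists w, w \in cls b0.
  apply/card_gt0P; case: posnP Ycls => // ->; rewrite muln0 leqn0 => /eqP Y0.
  by move: w0Y; rewrite (cards0_eq Y0) inE.
(* The union of the chosen paths rather than the class itself, so that these paths stay inside
   [X']. *)
pose X' := [set x | [exists w in cls b0, x \in (f w).2]].
have inX' w x : w \in cls b0 -> x \in (f w).2 -> x \in X'.
  by move=> wc xw; rewrite inE; apply/existsP; exists w; rewrite wc.
have clsX : cls b0 \subset X'.
  apply/subsetP => w wc; apply: (inX' w) => //.
  by move: wc; rewrite inE => /andP[wY _]; case: (fP _ wY).
have fring b : b \in D -> [exists x in s, g x b].
  rewrite inE => /andP[_ /existsP[x /andP[]]]; rewrite inE => xs xb.
  by apply/existsP; exists x; rewrite xs.
exists X', (entry Y D b0), b0; split.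
- move=> x; rewrite inE => /existsP[w /andP[wc xw]].
  exists (f w).2; move: (wc); rewrite inE => /andP[wY /eqP eb].
  have [_ _ sp _ _] := fP _ wY; rewrite eb in sp; split=> // y; exact: inX'.
- apply/subsetP => x; rewrite inE => /existsP[w /andP[wc xw]].
  by move: wc; rewrite inE => /andP[wY _]; have [_ _ _ H _] := fP _ wY; apply: H.
- apply: fring; move: w1c; rewrite inE => /andP[wY /eqP <-]; by case: (fP _ wY).
- exact: fring.
- rewrite -cY; apply: leq_trans Ycls _; rewrite leq_mul2l subset_leq_card ?orbT //.
Qed.

(* With a = j.-1, the quadratic (a^2 + a k) / (2 k) is the exact solution of
   f(j) = (j - 1) + f(j - k); [size t] counts vertices. *)
Lemma long_path_rec k j X u v :
  0 < k -> traversable X u v -> 2 ^ j <= #|X| ->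
  exists x y t, [/\ x \in [:: u; v], spath g x y t, {subset t <= X} &
    2 ^ k <= (size t).+1 \/
    j.-1 ^ 2 + j.-1 * k + 2 * k <= 2 * k * size t + 2 * k ^ 2].
Proof.
move=> k0; elim/ltn_ind: j X u v => j IHj X u v tX jX.
have [w wX] : exists w, w \in X.
  by apply/card_gt0P; apply: leq_trans jX; rewrite expn_gt0.
have [jk|kj] := leqP j.-1 k.
  exists u, u, [:: u]; split; rewrite ?mem_head //; first by rewrite /spath /= !eqxx.
    by have [s [ss sX _]] := tX _ wX; move=> x; rewrite inE => /eqP ->; apply/sX/spath_head/ss.
  (* For [j.-1 <= k] the left side is at most [2 * k ^ 2 + 2 * k], which a single vertex already
     reaches. *)
  by right; rewrite /=; nia.
(* The radius [j - 3] fits because 6 < 2 ^ 3, and [3 <= j] follows from [0 < k < j.-1]. The path has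
   at least [2 * j - 3] vertices. *)
have [|s [ss sX sz]] := @traversable_long _ _ _ (j - 3) tX.
  apply: leq_trans jX; rewrite -{2}[j](@subnK 3); last by lia.
  by rewrite expnD -[2 ^ 3]/8 mulnC ltn_pmul2l ?expn_gt0.
have [big|small] := leqP (2 ^ k) (size s).+1.
  by exists u, v, s; split; rewrite ?mem_head //; left.
have jjk : 2 ^ j = 2 ^ (j - k) * 2 ^ k by rewrite -expnD subnK //; lia.
have jk0 : 0 < 2 ^ (j - k) by rewrite expn_gt0.
have [|X' [a [b [tX' X'X sa sb cX']]]] := traversable_off_path tX ss sX; first by nia.
(* As [size s + 2 <= 2 ^ k], the subtracted [size s] is less than one multiple of [2 ^ k], and
   integrality recovers the full power. *)
have jX' : 2 ^ (j - k) <= #|X'| by nia.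
have jkj : j - k < j by lia.
have [x [y [t [xab st tX1 tsz]]]] := IHj _ jkj _ _ _ tX' jX'.
have {sa sb xab} /existsP[c /andP[cs cx]] : [exists c in s, g c x].
  by move: xab; rewrite !inE => /orP[] /eqP ->.
have ts z : z \in t -> (z \in X) && (z \notin s).
  by move=> /tX1 /(subsetP X'X); rewrite !inE andbC.
(* The vertex [c] splits [s] into two sides with at least [2 * j - 4] vertices in total; the longer
   one together with [c] has at least [j.-1]. *)
suff [z [q [zuv sq qs szq]]] : exists z q, [/\ z \in [:: u; v], spath g z c (rcons q c),
    {subset rcons q c <= s} & j.-1 <= (size q).+1].
  exists z, y, (rcons q c ++ t); split=> //.
  - have [t' et _] := spath_cons st.
    rewrite et spath_cat sq -et st cx /=; apply/hasPn => d /ts /andP[_ ds].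
    by apply: contra ds => /qs.
  - by move=> d; rewrite mem_cat => /orP[/qs/sX|/ts/andP[]].
  - rewrite size_cat size_rcons; case: tsz => [tsz|tsz]; [left|right].
      by apply: leq_trans tsz _; lia.
    have [a' ea] : exists a', j.-1 = a' + k by exists (j.-1 - k); lia.
    have ea' : (j - k).-1 = a' by lia.
    by move: tsz szq; rewrite ea ea'; nia.
case/path.splitPr: cs ss sz {ts small cX' sX X'X} => s1 s2.
rewrite spath_cat_mid size_cat /= => /and3P[p1 p2 _] sz.
have [le|lt] := leqP j.-1 (size s1).+1.
  exists u, s1; split; rewrite ?mem_head // => d.
  by rewrite -cat_rcons mem_cat => ->.
exists v, (rev s2); rewrite -rev_cons spath_rev // size_rev; split=> //.
- by rewrite !inE eqxx orbT.
- by move=> d; rewrite mem_rev mem_cat => ->; rewrite orbT.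
- move: k0 kj sz lt; move: (size s1) (size s2); clear; lia.
Qed.

(** * Ears and 2-connectivity *)

(** The stretch between [x] and the later vertex [z] is replaced by the detour through [y]. *)
Lemma spath_ear u v x y z r1 r2 t :
  spath g u v (r1 ++ x :: r2) -> g x y -> spath g y z (rcons t z) -> z \in r2 ->
  {in t, forall c, c \notin r1 ++ x :: r2} ->
  exists2 s, spath g u v s & y \in s.
Proof.
move=> sr xy st zr2; case/path.splitPr: zr2 sr => a b sr nt.
move: (sr); rewrite spath_cat_mid => /and3P[p1 + /hasPn n12].
rewrite -cat_cons spath_cat_mid => /and3P[p2 p3 /hasPn n23].
have st' : spath g y v (t ++ z :: b).
  rewrite spath_cat_mid st p3 /=; apply/hasPn => c cb /=; rewrite mem_rcons inE negb_or.
  apply/andP; split; first by have /= /andP[zb _] := spath_uniq p3; apply: contraNneq zb => <-.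
  by apply/negP => /nt; rewrite mem_cat inE mem_cat inE cb !orbT.
have [q eq _] := spath_cons st'.
exists (rcons r1 x ++ y :: q); last by rewrite mem_cat mem_head orbT.
rewrite spath_cat p1 -eq st' xy /=; apply/hasPn => c; rewrite mem_cat => /orP[ct|cb] /=.
  by apply: contra (nt _ ct); rewrite -cat_rcons mem_cat => ->.
by apply: n12; rewrite mem_cat cb orbT.
Qed.

Definition del w : rel V := fun x y => [&& g x y, x != w & y != w].

(** The vertices lying on some [u]-[v] path are closed under adjacency: a new neighbour [y] of a
    path vertex [x] reaches the rest of the path without [x], which gives an ear. Connectedness then
    spreads this from the edge [u v] to all vertices. *)
Lemma two_connected_traversable u v :
  (forall x y, connect g x y) ->
  (forall w x y, x != w -> y != w -> connect (del w) x y) ->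
  g u v -> traversable setT u v.
Proof.
move=> gconn gdel uv.
have nuv : u != v by apply: contraTneq uv => ->; rewrite g_irr.
have step x y : (exists2 s, spath g u v s & x \in s) -> g x y -> exists2 s, spath g u v s & y \in s.
  case=> s ss xs xy; case: (boolP (y \in s)) => [ys|ys]; first by exists s.
  have nyx : y != x by apply: contraTneq xy => ->; rewrite g_irr.
  pose S := [pred z in s | z != x].
  (* The ends [u] and [v] are distinct, so one of them differs from [x]. *)
  have [z0 z0S] : exists z, z \in S.
    have [exu|nux] := eqVneq x u; first by exists v; rewrite !inE (spath_last ss) exu eq_sym.
    by exists u; rewrite !inE (spath_head ss) eq_sym.
  have nz0x : z0 != x by move: z0S; rewrite inE => /andP[].
  have [t [z [st]]] := connect_first_hit (gdel _ _ _ nyx nz0x) z0S.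
  rewrite inE => /andP[/= zs zx] nt.
  have xt : x \notin t.
    have : x \notin rcons t z.
      have [p -> /and3P[pp _ _]] := spath_cons st.
      rewrite inE negb_or eq_sym nyx /=.
      elim: p y pp {st nyx ys xy} => //= a p IHp y /andP[/and3P[_ _ ax] /IHp xp].
      by rewrite inE negb_or [x == a]eq_sym ax.
    by apply: contra => H; rewrite mem_rcons inE H orbT.
  have {}nt : {in t, forall c, c \notin s}.
    move=> c ct; have := nt _ ct; rewrite inE /= negb_and negbK => /orP[//|/eqP cx].
    by move: xt; rewrite -cx ct.
  have {}st : spath g y z (rcons t z) by apply: sub_spath st => c d /and3P[].
  case/path.splitPr: xs zs nt ss {z0S S ys} => r1 r2.
  rewrite mem_cat inE (negbTE zx) /= => /orP[zr|zr] nt ss; last exact: spath_ear ss xy st zr nt.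
  (* If the ear returns before [x], the path is reversed so that [z] comes after [x]. *)
  have ss' : spath g v u (rev r2 ++ x :: rev r1).
    by rewrite -cat_rcons -rev_cons -rev_cat spath_rev.
  have [||s' ? ?] := spath_ear ss' xy st; first by rewrite mem_rev.
    move=> c /nt; apply: contra; rewrite !mem_cat !inE !mem_rev.
    by move/or3P => [] ->; rewrite ?orbT.
  by exists (rev s'); rewrite ?spath_rev ?mem_rev.
move=> w _; suff [s] : exists2 s, spath g u v s & w \in s.
  by exists s; split=> // x _; rewrite inE.
have /connectP[p pp ->] := gconn u w.
have : exists2 s, spath g u v s & u \in s.
  by exists [:: u; v]; rewrite ?mem_head // /spath /= !eqxx uv inE nuv.
(* Only the occurrences of [u] as start of the walk [p] are generalised; the end [u] of the [u]-[v]
   paths stays fixed. *)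
elim: p {1 3 5}u pp => //= a p IHp x /andP[xa pp] xg.
exact: IHp pp (step _ _ xg xa).
Qed.

End Subcubic.

(* zify rebinds the key %R to ring_scope. *)
Delimit Scope R_scope with R.

(** * Binary logarithms and the final estimate *)

Section Numerics.
Local Open Scope R_scope.

Lemma exp_ln2_pow k : exp (INR k * ln 2) = 2 ^ k.
Proof.
elim: k => [|k IHk]; first by rewrite Rmult_0_l exp_0.
by rewrite S_INR Rmult_plus_distr_r Rmult_1_l exp_plus IHk exp_ln /=; lra.
Qed.

Lemma ln2_gt0 : 0 < ln 2.
Proof. by rewrite -ln_1; apply: ln_increasing; lra. Qed.

Lemma exp_nondecreasing x y : x <= y -> exp x <= exp y.
Proof. by case=> [/exp_increasing/Rlt_le|->]; last exact: Rle_refl. Qed.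

Lemma exp_log2 x : 0 < x -> exp (log2 x * ln 2) = x.
Proof.
move=> x0; have := ln2_gt0 => l0; rewrite /log2.
have -> : ln x / ln 2 * ln 2 = ln x by field; lra.
exact: exp_ln.
Qed.

Lemma log2_ge k x : 2 ^ k <= x -> INR k <= log2 x.
Proof.
move=> kx; have l0 := ln2_gt0; have p0 : 0 < 2 ^ k by apply: pow_lt; lra.
apply: (Rmult_le_reg_r (ln 2)) => //.
apply: Rnot_lt_le => /exp_increasing; rewrite exp_ln2_pow exp_log2; lra.
Qed.

Lemma log2_lt k x : 0 < x -> x < 2 ^ k -> log2 x < INR k.
Proof.
move=> x0 kx; have l0 := ln2_gt0.
apply: (Rmult_lt_reg_r (ln 2)) => //.
apply: Rnot_le_lt => H; have := exp_nondecreasing H; rewrite exp_ln2_pow exp_log2; lra.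
Qed.

Lemma INR_expn m k : INR (expn m k) = INR m ^ k.
Proof. by elim: k => [|k IHk] //=; rewrite expnS mult_INR IHk. Qed.

Lemma nat_floor x : 0 <= x -> exists k, INR k <= x < INR k + 1.
Proof.
move=> x0; have [h1 h2] := archimed x.
have z0 : (0 < up x)%Z by apply: lt_IZR; lra.
exists (Z.to_nat (up x - 1)); rewrite INR_IZR_INZ Z2Nat.id ?minus_IZR; last by lia.
lra.
Qed.

(** Here [L] stands for the logarithm of the order, [J] for its integer part and [T] for the number
    of edges of the path. Taking [k] as the floor of [2 * log2 L] makes [2 ^ k] at least
    [L ^ 2 / 2], while [2 * k] stays below [1 + 4 * log2 L]. *)
Lemma length_bound L k J T :
  4 <= L -> L < J + 1 -> 0 <= T ->
  INR k <= 2 * log2 L < INR k + 1 ->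
  2 ^ k <= T + 2 \/ (J - 1) ^ 2 + (J - 1) * INR k <= 2 * INR k * T + 2 * INR k ^ 2 ->
  L ^ 2 / (1 + 4 * log2 L) - 36 * log2 L ^ 2 <= T.
Proof.
set lam := log2 L => L4 LJ T0 [k1 k2] H.
have lam2 : 2 <= lam by have := @log2_ge 2 L; rewrite -/lam /=; lra.
have sq0 : 0 <= L ^ 2 by apply: pow2_ge_0.
have d0 : 0 < 1 + 4 * lam by lra.
apply: (Rmult_le_reg_r (1 + 4 * lam)) => //.
have -> : (L ^ 2 / (1 + 4 * lam) - 36 * lam ^ 2) * (1 + 4 * lam) =
  L ^ 2 - 36 * lam ^ 2 * (1 + 4 * lam) by field; lra.
case: H => [H|H].
  have : L ^ 2 <= 2 * 2 ^ k.
    have -> : L ^ 2 = exp (2 * lam * ln 2).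
      rewrite (_ : 2 * lam * ln 2 = lam * ln 2 + lam * ln 2); last by ring.
      by rewrite exp_plus exp_log2; [ring|lra].
    rewrite -[2 * 2 ^ k]/(2 ^ k.+1) -exp_ln2_pow; apply: exp_nondecreasing.
    apply: Rmult_le_compat_r; first by have := ln2_gt0; lra.
    by rewrite S_INR; lra.
  nra.
have k4 : 3 < INR k by lra.
(* Rounding up from 3 matters: expanding [(L - 2) ^ 2 + (L - 2) * K] leaves the linear term
   [(K - 4) * L], which must not be negative. *)
have k4' : 4 <= INR k.
  have -> : 4 = INR 4 by rewrite /=; lra.
  apply: le_INR; have : 3 < INR k by []; have -> : 3 = INR 3 by rewrite /=; lra.
  by move/INR_lt; lia.
move: (INR k) H k1 k2 k4 k4' => K H k1 k2 _ k4.
have H1 : (L - 2) ^ 2 + (L - 2) * K <= 2 * K * T + 2 * K ^ 2 by nra.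
have H2 : L ^ 2 <= 2 * K * (T + K + 1) by nra.
(* The surplus [K + 1] is at most [2 * lam + 1], which [36 * lam ^ 2] absorbs. *)
have H3 : L ^ 2 <= (1 + 4 * lam) * (T + K + 1) by nra.
nra.
Qed.

End Numerics.

Theorem theorem24 :
  exists N : nat,
    forall (V E : finType) (ends : E -> V * V),
      (N <= #|V|)%N ->
      loopless ends -> cubic ends -> two_connected ends ->
      exists (x : V) (p : seq V),
        is_mpath ends x p /\
        (log2 (INR #|V|) ^ 2 / (1 + 4 * log2 (log2 (INR #|V|)))
           - 36 * log2 (log2 (INR #|V|)) ^ 2 <= INR (size p))%R.
Proof.
(* From 16 on, the logarithm is at least 4 and the iterated logarithm at least 2. *)
exists 16 => V E ends n16 noloop cub [_ conn conn_del].
set g := madj ends; set n := #|V| in n16 *.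
have g_sym : symmetric g.
  by move=> x y; apply: eq_existsb => e; rewrite orbC.
have g_irr : irreflexive g.
  move=> x; apply/existsP => -[e]; rewrite orbb => /eqP ee.
  by have := noloop e; rewrite ee eqxx.
have g_deg x : #|[set y | g x y]| <= 3.
  rewrite -(cub x) /mdeg.
  (* Neighbours are images of incident edges under the opposite end; parallel edges only make the
     image smaller. *)
  apply: leq_trans (leq_add (leq_imset_card (fun e => (ends e).2) _) (leq_imset_card (fun e => (ends e).1) _)).
  apply: leq_trans (leq_card_setU _ _); apply: subset_leq_card.
  apply/subsetP => y; rewrite !inE => /existsP[e /orP[] /eqP ee]; apply/orP; [left|right];
    by apply/imsetP; exists e; rewrite ?inE ee.
have [u [v uv]] : exists u v, g u v.
  have /card_gt1P[u [w [_ _ uw]]] : 1 < #|V| by apply: leq_trans n16.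
  have /connectP[[|v p] /= pp lp] := conn u w; first by rewrite lp eqxx in uw.
  by exists u, v; case/andP: pp.
have tV := two_connected_traversable g_sym g_irr conn conn_del uv.
have n0 : 0 < n by apply: leq_trans n16.
have /andP[J1 J2] := trunc_log_bounds (isT : 1 < 2) n0; set J := trunc_log 2 n in J1 J2.
have L4 : (4 <= log2 (INR n))%R.
  have -> : (4 = INR 4)%R by rewrite /=; lra.
  apply: log2_ge; have -> : (2 ^ 4 = INR 16)%R by rewrite /=; lra.
  by apply/le_INR/leP.
have LJ : (log2 (INR n) < INR J + 1)%R.
  rewrite -S_INR; apply: log2_lt; first by apply/(lt_INR 0)/ltP.
  have -> : (2 = INR 2)%R by rewrite /=; lra.
  by rewrite -INR_expn; apply/lt_INR/ltP.
have lam0 : (2 <= log2 (log2 (INR n)))%R by have := @log2_ge 2 (log2 (INR n)); rewrite /=; lra.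
have [|k kl] := @nat_floor (2 * log2 (log2 (INR n)))%R; first by lra.
have k0 : 0 < k by apply/ltP; apply: INR_lt; rewrite /=; lra.
have jV : 2 ^ J <= #|[set: V]| by rewrite cardsT.
have [x [y [t [_ st _ tsz]]]] := long_path_rec g_sym g_deg k0 tV jV.
have [p et /and3P[pp _ up]] := spath_cons st.
exists x, p; split; first by split.
apply: (length_bound L4 LJ (pos_INR _) kl).
have J0 : 0 < J by rewrite lt0n; apply: contraTneq J2 => ->; rewrite -leqNgt; apply: leq_trans n16.
have eJ : INR J.-1 = (INR J - 1)%R by rewrite -subn1 minus_INR //; apply/leP.
(* [t] has one vertex more than [p] has edges, which yields the [T + 2] and cancels the term
   [2 * k]. *)
move: tsz; rewrite et /= => -[] /leP/le_INR p0; [left|right].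
  by move: p0; rewrite INR_expn -[INR 2]/2%R !S_INR; lra.
move: p0; rewrite !plus_INR !mult_INR eJ (S_INR (size p)) /=; lra.
Qed.
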